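(* Let $d\ge2$ and let $\psi_1,\ldots,\psi_N$ be unit vectors in $\mathbb{C}^d$ with $|\langle\psi_i|\psi_j\rangle|=\frac1{\sqrt d}$ for all $i\ne j$. Then the state $$\rho=\frac1N\sum_{i=1}^N|\psi_i\rangle\langle\psi_i|\otimes|\psi_i\rangle\langle\psi_i|$$ on $\mathbb{C}^d\otimes\mathbb{C}^d$ lies on the kink at $\tilde{\mathcal{R}}^{(2)}(\rho)=\frac1N$, that is, $$\tilde{\mathcal{R}}^{(2)}(\rho)=\frac1N,\qquad \tilde{\mathcal{R}}^{(4)}(\rho)=\frac1{3N^2}+\frac{2}{3N^3}.$$
   Context: Correlation matrix: fix Hermitian $d\times d$ matrices $\lambda_0=\mathbb{1},\lambda_1,\ldots,\lambda_{d^2-1}$ with $\mathrm{Tr}(\lambda_i\lambda_j)=d\,\delta_{ij}$. For a density matrix $\rho$ on $\mathbb{C}^d\otimes\mathbb{C}^d$, its correlation matrix is the real $(d^2-1)\times(d^2-1)$ matrix $T$ with $T_{ij}=\mathrm{Tr}(\rho\,\lambda_i\otimes\lambda_j)$, $1\le i,j\le d^2-1$. Normalized second and fourth moments (independent of the chosen basis): $$\tilde{\mathcal{R}}^{(2)}(\rho)=\frac{\mathrm{Tr}(TT^\dagger)}{(d-1)^2},\qquad \tilde{\mathcal{R}}^{(4)}(\rho)=\frac{2\,\mathrm{Tr}(TT^\dagger TT^\dagger)+\mathrm{Tr}(TT^\dagger)^2}{3(d-1)^4}.$$ Kinks: the region of the $(\tilde{\mathcal{R}}^{(2)},\tilde{\mathcal{R}}^{(4)})$-plane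 allowed for separable states by the constraint $\|T\|_{\mathrm{Tr}}\le d-1$ has a piecewise-defined lower boundary. The kink at $\tilde{\mathcal{R}}^{(2)}=\frac1K$ (for $1\le K\le d^2-1$) is the point $\left(\frac1K,\ \frac1{3K^2}+\frac2{3K^3}\right)$ of this lower boundary; it is the moment point of correlation matrices having exactly $K$ nonzero singular values, all equal to $\frac{d-1}{K}$. *)

(* Defs.v *)
From mathcomp Require Import all_boot all_order all_algebra.
From mathcomp Require Import reals.
From mathcomp Require Import complex.
(* Not imported: the notation [A ^t k] of mxtens clashes with [A ^t*]. *)
From mathcomp Require mxtens.

Set Implicit Arguments.
Unset Strict Implicit.
Unset Printing Implicit Defensive.

Import Order.TTheory GRing.Theory Num.Theory.
Local Open Scope ring_scope.
Local Open Scope sesquilinear_scope.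

Notation "A *t B" := (mxtens.tensmx A B)
  (at level 40, left associativity) : ring_scope.

(* <phi|psi>, conjugate-linear in the first argument. *)
Definition braket (R : realType) d (phi psi : 'cV[R[i]]_d) : R[i] :=
  (phi^t* *m psi) 0 0.

(* |psi><psi| *)
Definition ketbra (R : realType) d (psi : 'cV[R[i]]_d) : 'M[R[i]]_d :=
  psi *m psi^t*.

(* lambda_0, ..., lambda_{d^2-1}; the index type has d^2 elements if d > 0. *)
Definition hermitian_basis (R : realType) d
    (lam : 'I_(d ^ 2 - 1).+1 -> 'M[R[i]]_d) : Prop :=
  [/\ lam ord0 = 1%:M,
      forall i, lam i \is hermsymmx &
      forall i j, \tr (lam i *m lam j) = d%:R * (i == j)%:R].

(* [lift ord0 i] is the index i + 1, so lambda_0 is skipped. The entries are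
   real numbers when rho is Hermitian, see [correlation_mx_real] below; they are
   kept in R[i] so that no real part has to be taken. *)
Definition correlation_mx (R : realType) d
    (lam : 'I_(d ^ 2 - 1).+1 -> 'M[R[i]]_d) (rho : 'M[R[i]]_(d * d)) :
    'M[R[i]]_(d ^ 2 - 1) :=
  \matrix_(i, j) \tr (rho *m (lam (lift ord0 i) *t lam (lift ord0 j))).

Definition moment2 (R : realType) d
    (lam : 'I_(d ^ 2 - 1).+1 -> 'M[R[i]]_d) (rho : 'M[R[i]]_(d * d)) : R[i] :=
  let T := correlation_mx lam rho in
  \tr (T *m T^t*) / (d%:R - 1) ^+ 2.

Definition moment4 (R : realType) d
    (lam : 'I_(d ^ 2 - 1).+1 -> 'M[R[i]]_d) (rho : 'M[R[i]]_(d * d)) : R[i] :=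
  let T := correlation_mx lam rho in
  (2 * \tr (T *m T^t* *m T *m T^t*) + \tr (T *m T^t*) ^+ 2)
    / (3 * (d%:R - 1) ^+ 4).

Definition kink (R : realType) (K : nat) : R[i] * R[i] :=
  (1 / K%:R, 1 / (3 * K%:R ^+ 2) + 2 / (3 * K%:R ^+ 3)).

(* There is a kink at 1/K only for 1 <= K <= d^2 - 1. *)
Definition lies_on_kink (R : realType) d
    (lam : 'I_(d ^ 2 - 1).+1 -> 'M[R[i]]_d) (rho : 'M[R[i]]_(d * d))
    (K : nat) : Prop :=
  (1 <= K <= d ^ 2 - 1)%N /\ (moment2 lam rho, moment4 lam rho) = kink R K.

Lemma correlation_mx_real (R : realType) d
    (lam : 'I_(d ^ 2 - 1).+1 -> 'M[R[i]]_d) (rho : 'M[R[i]]_(d * d)) i j :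
  hermitian_basis lam -> rho \is hermsymmx ->
  correlation_mx lam rho i j \is Num.real.
Proof.
have hermE n (A : 'M[R[i]]_n) : A \is hermsymmx -> A^t* = A.
  by move=> /is_hermitianmxP; rewrite expr0 scale1r => <-.
move=> [_ herm_lam _] herm_rho; apply/CrealP; rewrite mxE.
have trC n (A : 'M[R[i]]_n) : (\tr A)^* = \tr (A^t*).
  by rewrite rmorph_sum; apply: eq_bigr => k _; rewrite !mxE.
rewrite trC trmx_mul map_mxM mxtrace_mulC (hermE _ _ herm_rho).
congr (\tr (_ *m _)); apply/matrixP => k l; rewrite !mxE rmorphM.
by rewrite -[in RHS](hermE _ _ (herm_lam (lift ord0 i)))
  -[in RHS](hermE _ _ (herm_lam (lift ord0 j))) !mxE.
Qed.

(* Main.v *)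
(* The Bloch vectors b_k := (\tr (|psi_k><psi_k| lambda_i))_(i >= 1) satisfy, by
   completeness of the basis, b_k . b_l = d |<psi_k|psi_l>|^2 - 1. Hence they are
   pairwise orthogonal with squared norm d - 1, and T, which equals
   (1/N) \sum_k b_k b_k^T, satisfies T^2 = ((d - 1)/N) T. There are N nonzero
   orthogonal vectors in dimension d^2 - 1, hence N <= d^2 - 1. *)

Require Import Defs.
From mathcomp Require Import all_boot all_order all_algebra.
From mathcomp Require Import reals.
From mathcomp Require Import complex.
From mathcomp Require Import ring.

Set Implicit Arguments.
Unset Strict Implicit.
Unset Printing Implicit Defensive.

Import Order.TTheory GRing.Theory Num.Theory.
Local Open Scope ring_scope.
Local Open Scope sesquilinear_scope.

Lemma mxtrace_mul_mxvec (F : comPzRingType) m n (A : 'M[F]_(m, n))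
    (B : 'M[F]_(n, m)) :
  \tr (A *m B) = (mxvec A^T *m (mxvec B)^T) 0 0.
Proof.
rewrite mxE (reindex _ (curry_mxvec_bij _ _)) /=.
rewrite mxtrace_mulC /mxtrace.
under [LHS]eq_bigr => i _ do rewrite mxE.
rewrite pair_big /=; apply: eq_bigr => -[i j] _ /=.
by rewrite [(mxvec B)^T _ _]mxE !mxvecE mxE mulrC.
Qed.

Lemma mxtrace_tens (F : comPzRingType) m n (A : 'M[F]_m) (B : 'M[F]_n) :
  \tr (A *t B) = \tr A * \tr B.
Proof.
rewrite /mxtrace mxtens.mulr_sum.
by apply: eq_bigr => k _; rewrite !mxE.
Qed.

(** Parseval for the bilinear trace form: [d * d] orthogonal matrices of nonzero square fill the
    whole matrix space. *)
Lemma mxtrace_basis_complete (F : fieldType) d m (c : F)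
    (lam : 'I_m -> 'M[F]_d) :
  c != 0 -> m = (d * d)%N ->
  (forall i j, \tr (lam i *m lam j) = c * (i == j)%:R) ->
  forall A B, \sum_i \tr (A *m lam i) * \tr (B *m lam i) = c * \tr (A *m B).
Proof.
move=> c_neq0 m_eq; rewrite m_eq in lam * => orth A B.
(* The transpose in [L'] is the one that [mxtrace_mul_mxvec] puts on the left factor of a trace. *)
pose L := \matrix_i mxvec (lam i); pose L' := \matrix_i mxvec (lam i)^T.
have LL : L' *m L^T = c%:M.
  apply/matrixP => i j; rewrite [RHS]mxE -mulr_natr -orth mxtrace_mul_mxvec.
  by rewrite !mxE; apply: eq_bigr => k _; rewrite !mxE.
(* L and L' are square, so L' L^T = c also holds in the other order; this is
   the completeness relation. *)
have {}LL : L^T *m L' = c%:M.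
  have /mulmx1C : (c^-1 *: L') *m L^T = 1%:M.
    by rewrite -scalemxAl LL scale_scalar_mx mulVf.
  by rewrite -scalemxAr -[c%:M]scalemx1 => <-; rewrite scalerA mulfV ?scale1r.
transitivity ((mxvec A^T *m (L^T *m L') *m (mxvec B)^T) 0 0); last first.
  by rewrite LL mul_mx_scalar -scalemxAl mxE -mxtrace_mul_mxvec.
rewrite mulmxA -mulmxA mxE; apply: eq_bigr => i _; congr (_ * _).
  by rewrite mxtrace_mul_mxvec !mxE; apply: eq_bigr => k _; rewrite !mxE.
rewrite mxtrace_mulC mxtrace_mul_mxvec !mxE.
by apply: eq_bigr => k _; rewrite !mxE.
Qed.

Lemma mxtrace_mul_herm_real (R : realType) n (A B : 'M[R[i]]_n) :
  A^t* = A -> B^t* = B -> (\tr (A *m B))^* = \tr (A *m B).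
Proof.
move=> hA hB; rewrite [RHS]mxtrace_mulC -[in RHS]hA -[in RHS]hB -map_mxM.
by rewrite -trmx_mul rmorph_sum; apply: eq_bigr => k _; rewrite !mxE.
Qed.

Lemma ketbra_herm (R : realType) d (phi : 'cV[R[i]]_d) :
  (ketbra phi)^t* = ketbra phi.
Proof.
apply/matrixP => i j; rewrite !mxE rmorph_sum; apply: eq_bigr => k _.
by rewrite !mxE rmorphM /= conjCK mulrC.
Qed.

Lemma mxtrace_ketbra (R : realType) d (phi : 'cV[R[i]]_d) :
  \tr (ketbra phi) = braket phi phi.
Proof. by rewrite /ketbra mxtrace_mulC trace_mx11. Qed.

Lemma braket_conj (R : realType) d (phi chi : 'cV[R[i]]_d) :
  (braket phi chi)^* = braket chi phi.
Proof.
rewrite /braket !mxE rmorph_sum; apply: eq_bigr => k _.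
by rewrite !mxE rmorphM /= conjCK mulrC.
Qed.

Lemma mxtrace_ketbra_mul (R : realType) d (phi chi : 'cV[R[i]]_d) :
  \tr (ketbra phi *m ketbra chi) = `|braket phi chi| ^+ 2.
Proof.
rewrite normCK braket_conj /ketbra mulmxA mxtrace_mulC !mulmxA -mulmxA.
by rewrite trace_mx11 mulrC mxE big_ord1.
Qed.

Definition bloch_mx (R : realType) d N
    (lam : 'I_(d ^ 2 - 1).+1 -> 'M[R[i]]_d) (psi : 'I_N -> 'cV[R[i]]_d) :
    'M[R[i]]_(N, d ^ 2 - 1) :=
  \matrix_(k, i) \tr (ketbra (psi k) *m lam (lift ord0 i)).

Lemma bloch_mx_gram (R : realType) d N
    (lam : 'I_(d ^ 2 - 1).+1 -> 'M[R[i]]_d) (psi : 'I_N -> 'cV[R[i]]_d) :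
  (0 < d)%N -> hermitian_basis lam ->
  (forall i, braket (psi i) (psi i) = 1) ->
  (forall i j, i != j -> `|braket (psi i) (psi j)| = 1 / sqrtC d%:R) ->
  bloch_mx lam psi *m (bloch_mx lam psi)^T = (d%:R - 1)%:M.
Proof.
move=> d_gt0 [lam0 _ orth] unit overlap; apply/matrixP => k l.
have d_neq0 : d%:R != 0 :> R[i] by rewrite pnatr_eq0 -lt0n.
(* Subtraction on [nat] truncates, hence the appeal to [0 < d]. *)
have card : (d ^ 2 - 1).+1 = (d * d)%N.
  by rewrite subn1 prednK ?expn_gt0 ?d_gt0 // mulnn.
have := mxtrace_basis_complete d_neq0 card orth
  (ketbra (psi k)) (ketbra (psi l)).
(* The [lambda_0] term is a product of two unit traces; moved across, it is the [- 1] in the Bloch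
   inner product. *)
rewrite big_ord_recl lam0 !mulmx1 !mxtrace_ketbra !unit mulr1.
rewrite mxtrace_ketbra_mul => /(canRL (addKr _)) sum_eq.
transitivity (- 1 + d%:R * `|braket (psi k) (psi l)| ^+ 2).
  by rewrite -sum_eq mxE; apply: eq_bigr => i _; rewrite !mxE.
rewrite mxE; case: eqVneq => [->|kl].
  by rewrite unit normr1 expr1n mulr1 addrC.
by rewrite overlap // expr_div_n expr1n sqrtCK div1r mulfV ?addNr.
Qed.

(** Reconciles the adjoint used in the moments with the plain transpose of the Gram identity. *)
Lemma bloch_mx_real (R : realType) d N
    (lam : 'I_(d ^ 2 - 1).+1 -> 'M[R[i]]_d) (psi : 'I_N -> 'cV[R[i]]_d) :
  hermitian_basis lam -> map_mx Num.conj (bloch_mx lam psi) = bloch_mx lam psi.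
Proof.
move=> [_ herm _]; apply/matrixP => k i; rewrite !mxE.
apply: mxtrace_mul_herm_real; first exact: ketbra_herm.
by have /is_hermitianmxP := herm (lift ord0 i); rewrite expr0 scale1r => <-.
Qed.

(** The trace of a tensor product factors, so each product state contributes a rank-one term $b_k
    b_k^T$. *)
Lemma correlation_mx_bloch (R : realType) d N
    (lam : 'I_(d ^ 2 - 1).+1 -> 'M[R[i]]_d) (psi : 'I_N -> 'cV[R[i]]_d)
    (a : R[i]) :
  correlation_mx lam
    (a *: \sum_(i < N) (ketbra (psi i) *t ketbra (psi i))) =
  a *: ((bloch_mx lam psi)^T *m bloch_mx lam psi).
Proof.
apply/matrixP => i j; rewrite !mxE -scalemxAl mxtraceZ; congr (_ * _).
rewrite mulmx_suml raddf_sum; apply: eq_bigr => k _ /=.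
by rewrite mxtens.tensmx_mul mxtrace_tens !mxE.
Qed.

Theorem theorem3 (R : realType) (d N : nat) (d_ge2 : (2 <= d)%N)
    (N_ge1 : (1 <= N)%N)
    (lam : 'I_(d ^ 2 - 1).+1 -> 'M[R[i]]_d) (lam_basis : hermitian_basis lam)
    (psi : 'I_N -> 'cV[R[i]]_d)
    (psi_unit : forall i, braket (psi i) (psi i) = 1)
    (psi_overlap : forall i j, i != j ->
       `|braket (psi i) (psi j)| = 1 / sqrtC d%:R) :
  lies_on_kink lam
    (1 / N%:R *: \sum_(i < N) (ketbra (psi i) *t ketbra (psi i))) N.
Proof.
have gram := bloch_mx_gram (ltnW d_ge2) lam_basis psi_unit psi_overlap.
have N_neq0 : N%:R != 0 :> R[i] by rewrite pnatr_eq0 -lt0n.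
have d1_neq0 : d%:R - 1 != 0 :> R[i].
  by rewrite subr_eq0 pnatr_eq1 neq_ltn d_ge2 orbT.
split.
  rewrite N_ge1 /=.
  (* The Gram matrix is invertible of size [N], and its rank is at most the number of columns of the
     Bloch matrix. *)
  have : \rank ((d%:R - 1)%:M : 'M[R[i]]_N) = N.
    by rewrite -scalemx1 mxrank_scale_nz // mxrank1.
  rewrite -gram => {1}<-.
  exact: leq_trans (mxrankM_maxl _ _) (rank_leq_col _).
rewrite /moment2 /moment4 correlation_mx_bloch.
set B := bloch_mx lam psi; set T := (_ *: (B^T *m B)).
have T_herm : T^t* = T.
  rewrite /T linearZ /= trmx_mul trmxK map_mxZ map_mxM /=.
  rewrite fmorph_div rmorph1 rmorph_nat.
  by rewrite -map_trmx (bloch_mx_real psi lam_basis).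
pose c : R[i] := (d%:R - 1) / N%:R.
(* The inner factor [B *m B^T] of the square is the scalar Gram matrix. *)
have TT : T *m T = c *: T.
  rewrite /T -scalemxAl -scalemxAr mulmxA -[B^T *m B *m B^T]mulmxA gram.
  rewrite mul_mx_scalar -scalemxAl !scalerA; congr (_ *: _).
  by rewrite /c; field.
have trT : \tr T = d%:R - 1.
  rewrite /T mxtraceZ mxtrace_mulC gram mxtrace_scalar -mulr_natr.
  by field.
(* With its body visible, T itself would match the pattern of [scalemxAl]. *)
move: T T_herm TT trT => T T_herm TT trT.
(* Here $T^4 = c^3 T$, so the traces of $T^2$ and $T^4$ are $(d-1)^2/N$ and $(d-1)^4/N^3$. *)
rewrite T_herm TT -!scalemxAl TT -scalemxAl TT !mxtraceZ trT /kink /c.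
by congr (_, _); field; rewrite ?N_neq0 ?d1_neq0.
Qed.
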